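(* A countable anti-rectangular Abel Grassmann band is isomorphic to a proper subgroupoid of itself.
   Context: A groupoid is a nonempty set with a binary operation, written as juxtaposition. An anti-rectangular Abel Grassmann band is a groupoid satisfying $(xy)z=(zy)x$, $x = xx$ and $(xy)x=y$ for all elements $x,y,z$. Countable means of cardinality $\aleph_0$. A subgroupoid is a nonempty subset closed under the operation; it is proper if it is not the whole groupoid. *)

(* Defs.v *)
From mathcomp Require Import all_boot monoid.
From mathcomp Require Import boolp classical_sets functions cardinality.

Set Implicit Arguments.
Unset Strict Implicit.
Unset Printing Implicit Defensive.

Local Open Scope classical_set_scope.
Local Open Scope group_scope.

(* A magmaType may be empty, whereas a groupoid may not: hence the first
   component. *)
Definition anti_rectangular_AG_band (G : magmaType) : Prop :=
  [/\ [set: G] !=set0,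
      forall x y z : G, (x * y) * z = (z * y) * x,
      forall x : G, x = x * x
    & forall x y : G, (x * y) * x = y].

Definition subgroupoid (G : magmaType) (S : set G) : Prop :=
  S !=set0 /\ (forall x y : G, S x -> S y -> S (x * y)).

(* As S carries the operation of G, an isomorphism from G to the groupoid S is
   a multiplicative map from G to G that is a bijection onto S. *)
Definition isomorphic_to_subgroupoid (G : magmaType) (S : set G) : Prop :=
  exists f : {multiplicative G -> G}, set_bij [set: G] S f.

(* Main.v *)
Require Import Defs.
From HB Require Import structures.
From mathcomp Require Import all_boot monoid ssralg.
From mathcomp Require Import boolp classical_sets functions cardinality.

(** An anti-rectangular Abel Grassmann band is a vector space over the field
    F4 = {0, 1, w, w + 1}, w^2 = w + 1, in disguise: once a base point [o] is
    chosen as zero, it is an F4-space in which the product is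
    x y = w x + w^2 y.  The sum and the scalar w are recovered from the product
    as x + y = (o x)(y o) and w x = x o ([F4_structure_band], [band_mulE]).
    So any injective F4-linear map is an isomorphism of the band onto a
    subgroupoid, and it is enough to find one that is not surjective.

    A countably infinite F4-space has infinite dimension, hence is isomorphic to
    any of its hyperplanes.  Here the embedding is built directly, without a
    basis, by the forth half of a back-and-forth construction.  A partial
    embedding is identified with its graph, a finite F4-subspace of V x V.  A
    nonzero vector p is fixed, to be kept out of every image.  A partial
    embedding not defined at x is extended by sending x to a vector y outside
    the span of its image and p; such a y exists as that span is finite and V
    is infinite, and by exchange p remains outside the new image
    ([extend_partial_embedding]).  Meeting in turn all the vectors of V yields
    an increasing chain of graphs whose union is the graph of a total embedding
    that avoids p ([exists_embedding_avoiding]). *)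

Local Open Scope classical_set_scope.
Local Open Scope card_scope.

Import GRing.Theory.

Set Implicit Arguments.
Unset Strict Implicit.
Unset Printing Implicit Defensive.

(** * Vector spaces over the field with four elements *)

Section F4Spaces.
Local Open Scope ring_scope.

(** Scalar multiplication by F4 amounts to the action of a generator [w] in
    characteristic 2, subject to the minimal equation w^2 = w + 1. *)
Definition F4_structure (V : zmodType) (w : V -> V) : Prop :=
  [/\ {morph w : x y / x + y},
      forall x : V, x + x = 0
    & forall x : V, w (w x) = w x + x].

Definition prod_scalar (V W : zmodType) (v : V -> V) (w : W -> W) (z : V * W) :
  V * W := (v z.1, w z.2).

Lemma F4_structure_prod (V W : zmodType) (v : V -> V) (w : W -> W) :
  F4_structure v -> F4_structure w -> F4_structure (prod_scalar v w).
Proof.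
move=> [vD v2 vv] [wD w2 ww]; split=> [[x y] [x' y']|[x y]|[x y]].
- by congr pair; [exact: vD | exact: wD].
- by congr pair; [exact: v2 | exact: w2].
- by congr pair; [exact: vv | exact: ww].
Qed.

Section Subspaces.
Variables (V : zmodType) (w : V -> V).
Hypothesis hw : F4_structure w.

Let wD : {morph w : x y / x + y}. Proof. by case: hw. Qed.
Let addxx (x : V) : x + x = 0. Proof. by case: hw. Qed.
Let ww (x : V) : w (w x) = w x + x. Proof. by case: hw. Qed.

Definition subspace (S : set V) : Prop :=
  [/\ S 0, forall x y, S x -> S y -> S (x + y) & forall x, S x -> S (w x)].

(** The multiple of [x] by the scalar a + b w.  Natural numbers, of which only
    the parities matter, make these multiples add up without reduction. *)
Definition comb (a b : nat) (x : V) : V := x *+ a + w x *+ b.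

Definition adjoin (S : set V) (x : V) : set V :=
  [set z | exists2 s, S s & exists a b, z = s + comb a b x].

Lemma addKK (x y : V) : x + y + y = x.
Proof. by rewrite -addrA addxx addr0. Qed.

Lemma scalar0 : w 0 = 0.
Proof. by apply: (addrI (w 0)); rewrite -wD !addr0. Qed.

Lemma scalarMn (x : V) n : w (x *+ n) = w x *+ n.
Proof. by elim: n => [|n IHn]; rewrite ?mulr0n ?scalar0 // !mulrS wD IHn. Qed.

Lemma mulrn_odd (x : V) n : x *+ n = x *+ odd n.
Proof.
by rewrite -{1}(odd_double_half n) -muln2 mulrnDr mulnC mulrnA mulr2n addxx
  mul0rn addr0.
Qed.

Lemma comb_odd a b x : comb a b x = comb (odd a) (odd b) x.
Proof. by rewrite /comb mulrn_odd (mulrn_odd (w x)). Qed.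

Lemma comb_even a b x : ~~ (odd a || odd b) -> comb a b x = 0.
Proof.
by rewrite comb_odd negb_or => /andP[/negbTE-> /negbTE->]; rewrite /comb !mulr0n addr0.
Qed.

Lemma combD a b c d x : comb a b x + comb c d x = comb (a + c) (b + d) x.
Proof. by rewrite /comb addrACA -!mulrnDr. Qed.

Lemma scalar_comb a b x : w (comb a b x) = comb b (a + b) x.
Proof. by rewrite /comb wD !scalarMn ww mulrnDl mulrnDr addrA addrC. Qed.

(** The nonzero scalars of F4 are invertible, and [w] and [w + 1] are each
    other's inverse. The conclusion is about the scalar rather than the
    multiple so that it applies to both components of a multiple of a pair. *)
Lemma mem_of_comb S a b x :
  subspace S -> S (comb a b x) -> S x \/ ~~ (odd a || odd b).
Proof.
move=> [_ SD Sw]; rewrite comb_odd /comb.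
case: (odd a) (odd b) => [] [] /=; rewrite ?mulr0n ?mulr1n ?addr0 ?add0r;
  try by [left|right].
(* scalar w + 1, undone by w *)
- by move/Sw; rewrite wD ww addrC addrAC addxx add0r; left.
(* scalar w, undone by w + 1, that is by w^2 *)
- move=> Swx; left; rewrite -[x](addKK x (w x)) [x + _]addrC -ww.
  by apply: (SD) => //; apply: (Sw).
Qed.

Lemma subset_adjoin S x : S `<=` adjoin S x.
Proof. by move=> s Ss; exists s => //; exists 0%N, 0%N; rewrite comb_even ?addr0. Qed.

Lemma mem_adjoin S x : subspace S -> adjoin S x x.
Proof.
case=> S0 _ _; exists 0 => //; exists 1%N, 0%N.
by rewrite /comb mulr1n mulr0n addr0 add0r.
Qed.

Lemma subspace_adjoin S x : subspace S -> subspace (adjoin S x).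
Proof.
move=> sS; have [S0 SD Sw] := sS; split.
- exact/subset_adjoin.
- move=> _ _ [s Ss [a [b ->]]] [t St [c [d ->]]].
  by exists (s + t); [exact: SD | exists (a + c)%N, (b + d)%N; rewrite addrACA combD].
- move=> _ [s Ss [a [b ->]]]; exists (w s); first exact: Sw.
  by exists b, (a + b)%N; rewrite wD scalar_comb.
Qed.

Lemma finite_adjoin S x : finite_set S -> finite_set (adjoin S x).
Proof.
move=> finS.
apply: (@sub_finite_set _ _
  [set s + comb (c.1 : bool) (c.2 : bool) x | s in S & c in [set: bool * bool]]).
  move=> _ [s Ss [a [b ->]]]; exists s => //; exists (odd a, odd b) => //=.
  by rewrite -comb_odd.
by apply: finite_image2 => //; exact: finite_finset.
Qed.

End Subspaces.

(** * Embeddings that avoid a vector *)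

Section Embedding.
Variables (V : zmodType) (w : V -> V) (p : V).
Hypothesis hw : F4_structure w.
Let hww := F4_structure_prod hw hw.
Let ww := prod_scalar w w.

(** Linearity makes the usual conditions on a graph local at 0: the third clause
    says that [E] is single-valued, the fourth that it is injective. *)
Definition partial_embedding (E : set (V * V)) : Prop :=
  [/\ subspace ww E, finite_set E,
      forall y, E (0, y) -> y = 0,
      forall x, E (x, 0) -> x = 0
    & forall x, ~ E (x, p)].

Lemma subspace_image1 E : subspace ww E -> subspace w (fst @` E).
Proof.
move=> [E0 ED Ew]; split; first by exists 0.
- by move=> _ _ [z Ez <-] [t Et <-]; exists (z + t) => //; exact: ED.
- by move=> _ [z Ez <-]; exists (ww z) => //; exact: Ew.
Qed.

Lemma subspace_image2 E : subspace ww E -> subspace w (snd @` E).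
Proof.
move=> [E0 ED Ew]; split; first by exists 0.
- by move=> _ _ [z Ez <-] [t Et <-]; exists (z + t) => //; exact: ED.
- by move=> _ [z Ez <-]; exists (ww z) => //; exact: Ew.
Qed.

Lemma comb_pair a b x y : comb ww a b (x, y) = (comb w a b x, comb w a b y).
Proof.
have Mn (u v : V) n : (u, v) *+ n = (u *+ n, v *+ n).
  by elim: n => [|n IHn]; rewrite ?mulr0n // !mulrS IHn.
by rewrite /comb /ww /prod_scalar /= !Mn.
Qed.

(** Each way in which [E + F4 (x, y)] could fail to be a partial embedding puts
    a multiple of [x] in the domain of [E], or a multiple of [y] in the span of
    its image and [p]. If that multiple is nonzero, [x] or [y] itself lies there,
    against their choice; if it is zero, the failure already occurs in [E]. *)
Lemma extend_partial_embedding E x :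
  infinite_set [set: V] -> partial_embedding E ->
  exists F, [/\ partial_embedding F, E `<=` F & exists y, F (x, y)].
Proof.
move=> infV pE; have [sE finE E0l E0r Ep] := pE.
have [[[x' y] Exy /= <-]|domx] := pselect ((fst @` E) x).
  by exists E; split=> //; exists y.
have sI := subspace_image2 sE.
have finI : finite_set (adjoin w (snd @` E) p).
  by apply: (finite_adjoin hw); exact: finite_image.
have [y [_ Iy]] := infinite_setN0 (infinite_setD infV finI).
exists (adjoin ww E (x, y)); split; last 2 first.
- exact: (subset_adjoin hww).
- by exists y; exact: mem_adjoin.
have [_ addxx _] := hw.
split.
- exact: (subspace_adjoin hww).
- exact: (finite_adjoin hww).
- move=> v [[s t] Est [a [b]]]; rewrite comb_pair => -[/esym xE vE].
  have : (fst @` E) (comb w a b x).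
    by exists (s, t) => //=; rewrite -[RHS]add0r -xE (addKK hw).
  case/(mem_of_comb hw (subspace_image1 sE)) => [//|ev].
  by move: xE vE Est; rewrite !(comb_even hw) // !addr0 => -> ->; exact: E0l.
- move=> u [[s t] Est [a [b]]]; rewrite comb_pair => -[uE /esym yE].
  have : (snd @` E) (comb w a b y).
    by exists (s, t) => //=; rewrite -[RHS]add0r -yE (addKK hw).
  case/(mem_of_comb hw sI) => [sy|ev].
    by case: Iy; exact: (subset_adjoin hw).
  by move: uE yE Est; rewrite !(comb_even hw) // !addr0 => -> ->; exact: E0r.
- move=> u [[s t] Est [a [b]]]; rewrite comb_pair => -[uE /esym yE].
  have : adjoin w (snd @` E) p (comb w a b y).
    exists t; first by exists (s, t).
    exists 1%N, 0%N; rewrite /comb mulr1n mulr0n addr0 -/(comb w a b y) -yE addrA.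
    by rewrite addxx add0r.
  case/(mem_of_comb hw (subspace_adjoin hw _ sI)) => [//|ev].
  by move: yE Est; rewrite !(comb_even hw) // !addr0 => ->; exact: Ep.
Qed.

(** At stage n the n-th vector of an enumeration joins the domain, so the union
    of the chain is the graph of a total map. Linearity, injectivity and the
    avoidance of [p] involve finitely many points of the graph, hence hold
    because they hold at some stage. *)
Lemma exists_embedding_avoiding :
  p != 0 -> [set: V] #= [set: nat] ->
  exists f : V -> V, [/\ {morph f : x y / x + y},
    {morph f : x / w x}, injective f & forall x, f x <> p].
Proof.
move=> p0 cV.
have infV : infinite_set [set: V].
  by rewrite (eq_finite_set cV); exact: infinite_nat.
have [e e_surj] : exists e : nat -> V, forall x, exists n, e n = x.
  have : [set: V] #<= [set: nat] by move: cV; rewrite card_eq_le => /andP[].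
  case/pfcard_geP => [/seteqP[/(_ 0 I)//]|[e]].
  by exists e => x; have [n _ <-] := @surj _ _ _ _ e x I; exists n.
have pE0 : partial_embedding [set 0].
  split.
  - have [w0 [_ addxx _]] := (scalar0 hww, hww).
    by split=> // [x y -> ->|x ->]; rewrite ?addr0.
  - exact: finite_set1.
  - by move=> y [].
  - by move=> x [].
  - by move=> x [_ /eqP]; rewrite (negbTE p0).
pose P := {E | partial_embedding E}.
have [ext extP] : {ext : P * V -> P & forall Ex,
    sval Ex.1 `<=` sval (ext Ex) /\ exists y, sval (ext Ex) (Ex.2, y)}.
  apply: (choice (P := fun Ex F => sval Ex.1 `<=` sval F /\
    exists y, sval F (Ex.2, y))) => -[[E pE] x] /=.
  have [F [pF EF Fx]] := extend_partial_embedding x infV pE.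
  by exists (exist _ F pF); split.
pose E_ := fix E_ n : P :=
  if n is m.+1 then ext (E_ m, e m) else exist _ [set 0] pE0.
have E_S n : sval (E_ n) `<=` sval (E_ n.+1) := (extP (E_ n, e n)).1.
have E_mono m n : (m <= n)%N -> sval (E_ m) `<=` sval (E_ n).
  elim: n => [|n IHn]; first by rewrite leqn0 => /eqP->.
  rewrite leq_eqVlt => /orP[/eqP->//|/IHn mn].
  exact: subset_trans mn (E_S n).
pose Gr : set (V * V) := \bigcup_n sval (E_ n).
have Gr2 z t : Gr z -> Gr t -> exists n, sval (E_ n) z /\ sval (E_ n) t.
  move=> [m _ Em] [n _ En]; exists (maxn m n).
  by split; [apply: E_mono Em | apply: E_mono En]; rewrite ?leq_maxl ?leq_maxr.
have GrD z t : Gr z -> Gr t -> Gr (z + t).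
  move=> Gz Gt; have [n [nz nt]] := Gr2 _ _ Gz Gt.
  by exists n => //; case: (svalP (E_ n)) => -[_ ED _] _ _ _ _; exact: ED.
have Grw z : Gr z -> Gr (ww z).
  move=> [n _ nz]; exists n => //.
  by case: (svalP (E_ n)) => -[_ _ Ew] _ _ _ _; exact: Ew.
have Gr0l y : Gr (0, y) -> y = 0.
  by move=> [n _]; case: (svalP (E_ n)) => _ _ E0l _ _; exact: E0l.
have Gr0r x : Gr (x, 0) -> x = 0.
  by move=> [n _]; case: (svalP (E_ n)) => _ _ _ E0r _; exact: E0r.
have Grp x : ~ Gr (x, p).
  by move=> [n _]; case: (svalP (E_ n)) => _ _ _ _ Ep; exact: Ep.
have [f fP] : {f : V -> V & forall x, Gr (x, f x)}.
  apply: (choice (P := fun x y => Gr (x, y))) => x.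
  have [n <-] := e_surj x; have [y Ey] := (extP (E_ n, e n)).2.
  by exists y, n.+1.
have [_ addxx _] := hw.
have eq_of_add0 (x y : V) : x + y = 0 -> x = y.
  by move=> xy; rewrite -[x](addKK hw x y) xy add0r.
have f_uniq x y : Gr (x, y) -> f x = y.
  move=> Gxy; apply: eq_of_add0; apply: Gr0l.
  by have := GrD _ _ (fP x) Gxy; rewrite -[X in Gr X]/(x + x, f x + y) addxx.
exists f; split.
- by move=> x y; apply: f_uniq; exact: GrD (fP x) (fP y).
- by move=> x; apply: f_uniq; exact: Grw (fP x).
- move=> x y fxy; apply: eq_of_add0; apply: Gr0r.
  by have := GrD _ _ (fP x) (fP y); rewrite fxy -[X in Gr X]/(x + y, f y + f y) addxx.
- by move=> x fx; apply: (Grp x); rewrite -fx.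
Qed.

End Embedding.
End F4Spaces.

(** * The vector space underlying a band *)

Section BandAsF4Space.
Local Open Scope group_scope.

Section Identities.
Variable G : magmaType.
Hypothesis hG : anti_rectangular_AG_band G.

Lemma band_left_invertive (x y z : G) : x * y * z = z * y * x.
Proof. by case: hG. Qed.

Lemma band_idem (x : G) : x * x = x.
Proof. by case: hG. Qed.

Lemma band_mulKr (x y : G) : x * y * x = y.
Proof. by case: hG. Qed.

Lemma band_medial (x y z t : G) : (x * y) * (z * t) = (x * z) * (y * t).
Proof.
by rewrite band_left_invertive [z * t * y]band_left_invertive band_left_invertive.
Qed.

Lemma band_mulrK (x y : G) : x * (y * x) = y.
Proof. by rewrite -{1}(band_idem x) band_medial band_idem band_mulKr. Qed.

Lemma band_mulDl (x y z : G) : (x * y) * z = (x * z) * (y * z).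
Proof. by rewrite -{1}(band_idem z) band_medial. Qed.

Lemma band_mulDr (x y z : G) : x * (y * z) = (x * y) * (x * z).
Proof. by rewrite -{1}(band_idem x) band_medial. Qed.

Lemma band_mulrr (o x : G) : (x * o) * o = o * x.
Proof. by rewrite band_left_invertive band_idem. Qed.

Lemma band_mulll (o x : G) : o * (o * x) = x * o.
Proof. by rewrite -(band_mulrr o x) band_mulrK. Qed.

End Identities.

(** The carrier of [G] under another name that records [o], so that the vector
    space structure attached to it can depend on the base point. *)
Definition band_space (G : magmaType) (hG : anti_rectangular_AG_band G) (o : G) :
  Type := G.

Section Space.
Variables (G : magmaType) (hG : anti_rectangular_AG_band G) (o : G).
Local Notation V := (band_space hG o).

(** The product being w x + w^2 y, the map [o *] multiplies by w^2 and [* o] by w.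
    As w^3 = 1, multiplying the arguments by w^2 and w beforehand turns the
    product into the sum. *)
Definition band_add (x y : V) : V := ((o : G) * (x : G)) * ((y : G) * o).
Definition band_scalar (x : V) : V := (x : G) * o.

Lemma band_addC : commutative band_add.
Proof. by move=> x y; exact: band_medial. Qed.

Let band_addE (x y z : V) :
  band_add (band_add x y) z = ((x : G) * o * y) * ((z : G) * o).
Proof.
by rewrite /band_add (band_mulDr hG o (o * x)) (band_mulll hG) (band_mulrK hG).
Qed.

(** By [band_addE], exchanging the outer arguments of a double sum is an instance
    of the left invertive law; commutativity turns this into associativity. *)
Lemma band_addA : associative band_add.
Proof.
move=> x y z; rewrite [RHS]band_addE band_addC (band_addC y) band_addE.
exact: band_left_invertive.
Qed.

Lemma band_add0 : left_id (o : V) band_add.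
Proof. by move=> x; rewrite /band_add (band_idem hG) (band_mulrK hG). Qed.

Lemma band_addxx (x : V) : band_add x x = o.
Proof.
by rewrite /band_add (band_left_invertive hG) (band_mulKr hG) (band_idem hG).
Qed.

HB.instance Definition _ := gen_eqMixin V.
HB.instance Definition _ := gen_choiceMixin V.
HB.instance Definition _ :=
  GRing.isZmodule.Build V band_addA band_addC band_add0 band_addxx.

Lemma F4_structure_band : F4_structure band_scalar.
Proof.
split=> [x y|x|x].
- rewrite /GRing.add /= /band_add /band_scalar (band_mulDl hG).
  by rewrite (band_mulKr hG) (band_mulrK hG).
- exact: band_addxx.
(* w x + x simplifies to x (x o). With its first factor written (o x) o, the
   medial law makes this ((o x) x) o = (x o) o. *)
- rewrite /GRing.add /= /band_add /band_scalar (band_mulrK hG).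
  rewrite -{2}(band_mulKr hG o x) (band_medial hG) (band_idem hG).
  by rewrite (band_left_invertive hG o x) (band_idem hG).
Qed.

Lemma band_mulE (x y : V) :
  (x : G) * (y : G) = (band_scalar x + band_scalar (band_scalar y))%R.
Proof.
rewrite /GRing.add /= /band_add /band_scalar (band_mulrK hG).
by rewrite (band_mulrr hG o y) (band_mulKr hG).
Qed.

End Space.
End BandAsF4Space.

(** * Embedding a band in itself *)

Theorem corollary10 (G : magmaType) :
  anti_rectangular_AG_band G ->
  [set: G] #= [set: nat] ->
  exists S : set G,
    [/\ subgroupoid S, S `<` [set: G] & isomorphic_to_subgroupoid S].
Proof.
move=> hG cG; have [[o _] _ _ _] := hG.
have [p po] : exists p : band_space hG o, p != 0%R.
  apply: contrapT => /forallNP all0.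
  apply: infinite_nat; rewrite -(eq_finite_set cG).
  apply: (sub_finite_set _ (finite_set1 o)) => x _.
  by have /negP := all0 x; rewrite negbK => /eqP.
have [f [fD fw f_inj fp]] := exists_embedding_avoiding (F4_structure_band hG o) po cG.
have fM : {morph (f : G -> G) : x y / (x * y)%g}.
  by move=> x y; rewrite !(@band_mulE _ hG o) fD !fw.
exists (range f); split.
- split; first by exists (f o), o.
  by move=> _ _ [x _ <-] [y _ <-]; exists (x * y)%g => //; exact: fM.
- by split=> // sub; have [x _] := sub p I; exact: fp.
- pose fm := isMultiplicative.Build G G f fM.
  exists (HB.pack_for {multiplicative G -> G} (f : G -> G) fm); split.
  + by move=> x _; exists x.
  + by move=> x y _ _; exact: f_inj.
  + by [].
Qed.
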